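(* Let $\mathcal{V}$ be a variety of quandles. The following are equivalent: (i) $\mathcal{V}$ contains a non-trivial abelian quandle. (ii) $\mathcal{V}$ contains a non-trivial finite quandle. In particular, $\mathcal{V}$ is congruence distributive if and only if $\mathcal{V}$ contains no non-trivial finite quandle.
   Context: A quandle is an algebra $(Q,*,\backslash)$ with two binary operations satisfying $x*(x\backslash y)\approx y\approx x\backslash(x*y)$, $x*x\approx x$ and $x*(y*z)\approx(x*y)*(x*z)$. Varieties, terms and congruences are with respect to the signature $\{*,\backslash\}$. An algebra is non-trivial if it has more than one element. An algebra $A$ is abelian if $[1_A,1_A]=0_A$ for the commutator of congruences, i.e. if for every term $t(x,y_1,\ldots,y_n)$ and all $a,b,u_i,v_i\in A$, $t(a,u_1,\ldots,u_n)=t(a,v_1,\ldots,v_n)$ implies $t(b,u_1,\ldots,u_n)=t(b,v_1,\ldots,v_n)$. A variety is congruence distributive if all its members have distributive congruence lattices. *)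

(* Defs.v *)
From mathcomp Require Import all_boot.
From mathcomp Require Import classical_sets cardinality.

Set Implicit Arguments.
Unset Strict Implicit.
Unset Printing Implicit Defensive.

Record quandle := Quandle {
  quandle_sort :> Type;
  qmul : quandle_sort -> quandle_sort -> quandle_sort;
  qldiv : quandle_sort -> quandle_sort -> quandle_sort;
  qldivK : forall x y, qmul x (qldiv x y) = y;
  qmulK : forall x y, qldiv x (qmul x y) = y;
  qmulxx : forall x, qmul x x = x;
  qmulDr : forall x y z, qmul x (qmul y z) = qmul (qmul x y) (qmul x z)
}.

Inductive qterm (X : Type) : Type :=
  | qVar of X
  | qMul of qterm X & qterm X
  | qLdiv of qterm X & qterm X.

Fixpoint qeval (X : Type) (Q : quandle) (e : X -> Q) (t : qterm X) : Q :=
  match t with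
  | qVar x => e x
  | qMul t1 t2 => qmul (qeval e t1) (qeval e t2)
  | qLdiv t1 t2 => qldiv (qeval e t1) (qeval e t2)
  end.

Definition satisfies (Q : quandle) (s t : qterm nat) : Prop :=
  forall e : nat -> Q, qeval e s = qeval e t.

(* Varieties are equational classes; [E] is an arbitrary set of identities.
   The quandle axioms need not belong to [E], being part of [quandle]. *)
Definition variety (V : quandle -> Prop) : Prop :=
  exists E : qterm nat -> qterm nat -> Prop,
    forall Q : quandle, V Q <-> (forall s t, E s t -> satisfies Q s t).

Definition nontrivial (Q : quandle) : Prop := exists x y : Q, x <> y.

Definition finite_quandle (Q : quandle) : Prop := finite_set [set: Q].

(* The assignment x := a, y_i := u i; [None] stands for the variable x. *)
Definition assign (Q : quandle) (n : nat) (a : Q) (u : 'I_n -> Q)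
    (z : option 'I_n) : Q :=
  if z is Some i then u i else a.

(* [1_Q, 1_Q] = 0_Q, expressed as the term condition. *)
Definition abelian_quandle (Q : quandle) : Prop :=
  forall (n : nat) (t : qterm (option 'I_n)) (a b : Q) (u v : 'I_n -> Q),
    qeval (assign a u) t = qeval (assign a v) t ->
    qeval (assign b u) t = qeval (assign b v) t.

Record congruence (Q : quandle) (R : Q -> Q -> Prop) : Prop := Congruence {
  congruence_equiv : RelationClasses.Equivalence R;
  congruence_mul : forall x x' y y',
    R x x' -> R y y' -> R (qmul x y) (qmul x' y');
  congruence_ldiv : forall x x' y y',
    R x x' -> R y y' -> R (qldiv x y) (qldiv x' y')
}.

Definition cmeet (Q : quandle) (R S : Q -> Q -> Prop) (x y : Q) : Prop :=
  R x y /\ S x y.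

(* The least congruence above [R] and [S]. *)
Definition cjoin (Q : quandle) (R S : Q -> Q -> Prop) (x y : Q) : Prop :=
  forall T : Q -> Q -> Prop, congruence T ->
    (forall a b, R a b -> T a b) -> (forall a b, S a b -> T a b) -> T x y.

Definition distributive_congruences (Q : quandle) : Prop :=
  forall R S T : Q -> Q -> Prop,
    congruence R -> congruence S -> congruence T ->
    forall x y : Q,
      cmeet R (cjoin S T) x y <-> cjoin (cmeet R S) (cmeet R T) x y.

Definition congruence_distributive (V : quandle -> Prop) : Prop :=
  forall Q : quandle, V Q -> distributive_congruences Q.

(* Main.v *)
From HB Require Import structures.
From mathcomp Require Import all_boot all_order all_algebra all_fingroup.
From mathcomp Require Import all_solvable all_character.
From mathcomp Require Import boolp classical_sets cardinality.
Require Import Defs.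
From mathcomp Require Import ring zify.

Set Implicit Arguments.
Unset Strict Implicit.
Unset Printing Implicit Defensive.

(** If every identity of V has the same rightmost variable on both sides, then V
contains the projection quandle on Z/2, which is finite and abelian, and whose
square has a non-distributive congruence lattice.  Otherwise some identity
forces V to have a Mal'cev term.  Then everything reduces to non-trivial affine
quandles x * y = x - T x + T y on an abelian group:
- a medial quandle is affine, with x + y = p(x, 0, y);
- an abelian quandle is medial;
- a minimal non-trivial finite quandle Q is medial: its translation group is
  a Frobenius group on Q, whose kernel is a p-group by the existence of an
  invariant Sylow subgroup, then abelian by minimality;
- if the congruences R, S, T violate distributivity, the commutator of
  R /\ (S \/ T) with itself lies below N = (R /\ S) \/ (R /\ T), so that the
  blocks of the former modulo N are medial;
- an affine quandle satisfying the above identity is a Z[X]-module killed by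
  some h with h(1) = 1, so its cyclic submodules have finite quotients modulo a
  prime. *)

(** * Homomorphisms, products, subquandles and quotients inside a variety *)

Definition qhom (P Q : quandle) (f : P -> Q) :=
  forall x y, f (qmul x y) = qmul (f x) (f y).

Section Homomorphisms.
Variables (P Q : quandle) (f : P -> Q).
Hypothesis fM : qhom f.

Lemma qhom_ldiv x y : f (qldiv x y) = qldiv (f x) (f y).
Proof. by rewrite -{2}(qldivK x y) fM qmulK. Qed.

Lemma qhom_eval X (e : X -> P) t : f (qeval e t) = qeval (f \o e) t.
Proof.
by elim: t => //= t1 IH1 t2 IH2; rewrite ?fM ?qhom_ldiv IH1 IH2.
Qed.

Lemma satisfies_inj s t : injective f -> satisfies Q s t -> satisfies P s t.
Proof. by move=> f_inj sat e; apply: f_inj; rewrite !qhom_eval. Qed.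

Lemma satisfies_surj s t :
  (forall y, exists x, f x = y) -> satisfies P s t -> satisfies Q s t.
Proof.
move=> /choice[g fgK] sat e.
have -> : e = f \o (g \o e) by apply: funext => n /=; rewrite fgK.
by rewrite -!qhom_eval sat.
Qed.

End Homomorphisms.

Lemma variety_inj V (P Q : quandle) (f : P -> Q) :
  variety V -> qhom f -> injective f -> V Q -> V P.
Proof.
move=> [E VE] fM f_inj /VE VQ; apply/VE => s t Est.
exact: (satisfies_inj fM f_inj (VQ _ _ Est)).
Qed.

Lemma variety_surj V (P Q : quandle) (f : P -> Q) :
  variety V -> qhom f -> (forall y, exists x, f x = y) -> V P -> V Q.
Proof.
move=> [E VE] fM f_surj /VE VP; apply/VE => s t Est.
exact: (satisfies_surj fM f_surj (VP _ _ Est)).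
Qed.

Section Products.
Variables P Q : quandle.

Definition pair_mul (x y : P * Q) := (qmul x.1 y.1, qmul x.2 y.2).
Definition pair_ldiv (x y : P * Q) := (qldiv x.1 y.1, qldiv x.2 y.2).

Lemma pair_ldivK x y : pair_mul x (pair_ldiv x y) = y.
Proof. by case: y => y1 y2; rewrite /pair_mul /= !qldivK. Qed.
Lemma pair_mulK x y : pair_ldiv x (pair_mul x y) = y.
Proof. by case: y => y1 y2; rewrite /pair_ldiv /= !qmulK. Qed.
Lemma pair_mulxx x : pair_mul x x = x.
Proof. by case: x => x1 x2; rewrite /pair_mul /= !qmulxx. Qed.
Lemma pair_mulDr x y z :
  pair_mul x (pair_mul y z) = pair_mul (pair_mul x y) (pair_mul x z).
Proof. by rewrite /pair_mul /=; congr pair; apply: qmulDr. Qed.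

Definition pair_quandle :=
  Quandle pair_ldivK pair_mulK pair_mulxx pair_mulDr.

Lemma pair_eval X (e : X -> pair_quandle) t :
  qeval e t = (qeval (fst \o e) t, qeval (snd \o e) t).
Proof.
rewrite -(qhom_eval (P := pair_quandle) (fun _ _ => erefl) e).
rewrite -(qhom_eval (P := pair_quandle) (Q := Q) (fun _ _ => erefl) e).
by rewrite -surjective_pairing.
Qed.

End Products.

Lemma variety_pair V (P Q : quandle) : variety V -> V P -> V Q -> V (pair_quandle P Q).
Proof.
move=> [E VE] /VE VP /VE VQ; apply/VE => s t Est e.
by rewrite !pair_eval (VP _ _ Est) (VQ _ _ Est).
Qed.

Lemma sig_inj T (A : T -> Prop) : injective (@proj1_sig T A).
Proof. by move=> [x Ax] [y Ay] /= xy; apply: eq_exist. Qed.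

Section Subquandles.
Variables (Q : quandle) (A : Q -> Prop).
Hypothesis AM : forall x y, A x -> A y -> A (qmul x y).
Hypothesis AD : forall x y, A x -> A y -> A (qldiv x y).

Definition sub_mul (x y : {x | A x}) : {x | A x} :=
  exist _ _ (AM (proj2_sig x) (proj2_sig y)).
Definition sub_ldiv (x y : {x | A x}) : {x | A x} :=
  exist _ _ (AD (proj2_sig x) (proj2_sig y)).

Lemma sub_ldivK x y : sub_mul x (sub_ldiv x y) = y.
Proof. by apply: sig_inj; rewrite /= qldivK. Qed.
Lemma sub_mulK x y : sub_ldiv x (sub_mul x y) = y.
Proof. by apply: sig_inj; rewrite /= qmulK. Qed.
Lemma sub_mulxx x : sub_mul x x = x.
Proof. by apply: sig_inj; rewrite /= qmulxx. Qed.
Lemma sub_mulDr x y z : sub_mul x (sub_mul y z) = sub_mul (sub_mul x y) (sub_mul x z).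
Proof. by apply: sig_inj; rewrite /= qmulDr. Qed.

Definition sub_quandle := Quandle sub_ldivK sub_mulK sub_mulxx sub_mulDr.

Lemma variety_sub V : variety V -> V Q -> V sub_quandle.
Proof.
move=> vV; apply: (variety_inj (f := @proj1_sig _ A : sub_quandle -> Q)) => //.
exact: (@sig_inj _ A).
Qed.

End Subquandles.

Section Quotients.
Variables (Q : quandle) (R : Q -> Q -> Prop).
Hypothesis cR : congruence R.

Let Rxx x : R x x. Proof. by case: cR => -[]. Qed.
Let Rsym x y : R x y -> R y x. Proof. by case: cR => -[_ + _ _ _]; apply. Qed.
Let Rtrans y x z : R x y -> R y z -> R x z.
Proof. by case: cR => -[_ _ + _ _]; apply. Qed.

(** Classes are predicates, so extensionality makes related elements have equal classes; [quot_repr]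
    picks representatives by choice. *)
Definition quot_type := {B : Q -> Prop | exists x, B = R x}.
Definition quot_pi x : quot_type := exist _ (R x) (ex_intro _ x erefl).
Definition quot_repr (B : quot_type) : Q := projT1 (cid (proj2_sig B)).

Lemma quot_reprK B : quot_pi (quot_repr B) = B.
Proof. by apply: sig_inj; rewrite /= /quot_repr; case: cid. Qed.

Lemma quot_piP x y : quot_pi x = quot_pi y <-> R x y.
Proof.
split=> [[/(congr1 (@^~ y))]|Rxy]; first by move=> /= ->.
apply: sig_inj; apply: funext => z; apply: propext; split.
  by apply: Rtrans; apply: Rsym.
exact: Rtrans.
Qed.

Lemma quot_pi_repr x : R (quot_repr (quot_pi x)) x.
Proof. by apply/quot_piP; rewrite quot_reprK. Qed.

Definition quot_mul B C := quot_pi (qmul (quot_repr B) (quot_repr C)).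
Definition quot_ldiv B C := quot_pi (qldiv (quot_repr B) (quot_repr C)).

Lemma quot_mulE x y : quot_mul (quot_pi x) (quot_pi y) = quot_pi (qmul x y).
Proof. by apply/quot_piP; apply: (congruence_mul cR); apply: quot_pi_repr. Qed.
Lemma quot_ldivE x y : quot_ldiv (quot_pi x) (quot_pi y) = quot_pi (qldiv x y).
Proof. by apply/quot_piP; apply: (congruence_ldiv cR); apply: quot_pi_repr. Qed.

Lemma quot_ldivK B C : quot_mul B (quot_ldiv B C) = C.
Proof.
by rewrite -(quot_reprK B) -(quot_reprK C) quot_ldivE quot_mulE qldivK.
Qed.
Lemma quot_mulK B C : quot_ldiv B (quot_mul B C) = C.
Proof.
by rewrite -(quot_reprK B) -(quot_reprK C) quot_mulE quot_ldivE qmulK.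
Qed.
Lemma quot_mulxx B : quot_mul B B = B.
Proof. by rewrite -(quot_reprK B) quot_mulE qmulxx. Qed.
Lemma quot_mulDr B C D :
  quot_mul B (quot_mul C D) = quot_mul (quot_mul B C) (quot_mul B D).
Proof.
rewrite -(quot_reprK B) -(quot_reprK C) -(quot_reprK D).
by rewrite !quot_mulE qmulDr.
Qed.

Definition quot_quandle := Quandle quot_ldivK quot_mulK quot_mulxx quot_mulDr.

Lemma quot_pi_hom : qhom (quot_pi : Q -> quot_quandle).
Proof. by move=> x y; rewrite -quot_mulE. Qed.

Lemma variety_quot V : variety V -> V Q -> V quot_quandle.
Proof.
move=> vV; apply: variety_surj vV quot_pi_hom _ => B.
by exists (quot_repr B); apply: quot_reprK.
Qed.

End Quotients.

(** * Mediality of abelian quandles *)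

Definition medial (Q : quandle) := forall x y u v : Q,
  qmul (qmul x y) (qmul u v) = qmul (qmul x u) (qmul y v).

(** The term condition is applied to [(X * y_0) * y_1]. For [X = y] the two values agree, by
    idempotence and left distributivity; passing to [X = x] yields mediality. *)
Lemma abelian_medial Q : abelian_quandle Q -> medial Q.
Proof.
move=> abQ x y u v.
pose t : qterm (option 'I_2) :=
  qMul (qMul (qVar None) (qVar (Some ord0))) (qVar (Some ord_max)).
pose c (p q : Q) (i : 'I_2) := if i == ord0 then p else q.
have := abQ 2 t y x (c y (qmul u v)) (c u (qmul y v)).
by rewrite /= /c /= qmulxx -qmulDr; apply.
Qed.

(** * Words of left translations and the Mal'cev term *)

Fixpoint rightmost (X : Type) (t : qterm X) : X :=
  match t with
  | qVar x => x
  | qMul _ t2 => rightmost t2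
  | qLdiv _ t2 => rightmost t2
  end.

Section RightmostVariable.
Variable X : Type.

(* The value of [t] when the rightmost occurrence of a variable is given the
   value [z]; a word of left translations applied to [z]. *)
Fixpoint qact (Q : quandle) (e : X -> Q) t z :=
  match t with
  | qVar _ => z
  | qMul t1 t2 => qmul (qeval e t1) (qact e t2 z)
  | qLdiv t1 t2 => qldiv (qeval e t1) (qact e t2 z)
  end.

Fixpoint qact_inv (Q : quandle) (e : X -> Q) t z :=
  match t with
  | qVar _ => z
  | qMul t1 t2 => qact_inv e t2 (qldiv (qeval e t1) z)
  | qLdiv t1 t2 => qact_inv e t2 (qmul (qeval e t1) z)
  end.

Lemma qact_rightmost (Q : quandle) (e : X -> Q) t :
  qact e t (e (rightmost t)) = qeval e t.
Proof. by elim: t => //= t1 _ t2 ->. Qed.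

Lemma qactK (Q : quandle) (e : X -> Q) t : cancel (qact e t) (qact_inv e t).
Proof.
by elim: t => //= t1 _ t2 IH z; rewrite ?qmulK ?qldivK.
Qed.

Lemma qact_invK (Q : quandle) (e : X -> Q) t : cancel (qact_inv e t) (qact e t).
Proof.
by elim: t => //= t1 _ t2 IH z; rewrite IH ?qmulK ?qldivK.
Qed.

Lemma qhom_act (P Q : quandle) (f : P -> Q) (e : X -> P) t z :
  qhom f -> f (qact e t z) = qact (f \o e) t (f z).
Proof.
move=> fM; elim: t => //= t1 _ t2 IH.
  by rewrite fM IH (qhom_eval fM).
by rewrite (qhom_ldiv fM) IH (qhom_eval fM).
Qed.

Lemma qhom_act_inv (P Q : quandle) (f : P -> Q) (e : X -> P) t z :
  qhom f -> f (qact_inv e t z) = qact_inv (f \o e) t (f z).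
Proof.
move=> fM; elim: t z => //= t1 _ t2 IH z.
  by rewrite IH (qhom_ldiv fM) (qhom_eval fM).
by rewrite IH fM (qhom_eval fM).
Qed.

End RightmostVariable.

(* Naturality under homomorphisms stands for [p] being given by a term. *)
Definition malcev (V : quandle -> Prop) (p : forall Q : quandle, Q -> Q -> Q -> Q) :=
  (forall (P Q : quandle) (f : P -> Q) x y z,
    qhom f -> f (p P x y z) = p Q (f x) (f y) (f z))
  /\ (forall Q, V Q -> forall x y, p Q x y y = x /\ p Q x x y = y).

(* The identity [s = r] gives a word [w x y] of translations, depending on [x]
   and [y], that maps [x] to [y]; then [p x y z = w y z ((w y y)^-1 x)]. *)
Lemma malcev_exists (V : quandle -> Prop) s r :
  rightmost s <> rightmost r -> (forall Q, V Q -> satisfies Q s r) ->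
  exists p, malcev V p.
Proof.
move=> /eqP srN Vsr.
pose e (Q : quandle) (x y : Q) n := if n == rightmost s then x else y.
pose w (Q : quandle) (x y z : Q) := qact_inv (e Q x y) r (qact (e Q x y) s z).
pose w' (Q : quandle) (x y z : Q) := qact_inv (e Q x y) s (qact (e Q x y) r z).
(* The word of [s] takes [x], the value of its rightmost variable, to the common value of both
   sides; the inverse word of [r] takes that to [y], the value of the rightmost variable of [r]. *)
have wE Q x y : V Q -> w Q x y x = y.
  move=> VQ; rewrite /w.
  have := qact_rightmost (e Q x y) s; rewrite {2}/e eqxx => ->.
  rewrite (Vsr Q VQ) -qact_rightmost qactK /e.
  by rewrite eq_sym (negbTE srN).
have wK Q x y z : w Q x y (w' Q x y z) = z by rewrite /w /w' qact_invK qactK.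
have w'K Q x y z : w' Q x y (w Q x y z) = z by rewrite /w /w' qact_invK qactK.
exists (fun Q x y z => w Q y z (w' Q y y x)); split.
  move=> P Q f x y z fM.
  have fe u v : f \o e P u v = e Q (f u) (f v).
    by apply: funext => n; rewrite /e /=; case: ifP.
  rewrite /w /w' (qhom_act_inv _ _ _ fM) (qhom_act _ _ _ fM).
  by rewrite (qhom_act_inv _ _ _ fM) (qhom_act _ _ _ fM) !fe.
move=> Q VQ x y; split=> /=; first exact: wK.
by have := w'K Q x x x; rewrite wE // => ->; apply: wE.
Qed.

(** * Linear identities in abelian groups *)

Import Order.TTheory GRing.Theory Num.Theory.
Local Open Scope ring_scope.

(* Identities of abelian groups, which [ring] does not handle. *)
Inductive zexp := ZVar of nat | ZZero | ZAdd of zexp & zexp | ZOpp of zexp.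

Section ZmoduleReflection.
Variables (V : zmodType) (env : seq V).

Fixpoint zeval e : V :=
  match e with
  | ZVar i => env`_i
  | ZZero => 0
  | ZAdd e1 e2 => zeval e1 + zeval e2
  | ZOpp e1 => - zeval e1
  end.

Fixpoint zcoef e (i : nat) : int :=
  match e with
  | ZVar j => (i == j)%:R
  | ZZero => 0
  | ZAdd e1 e2 => zcoef e1 i + zcoef e2 i
  | ZOpp e1 => - zcoef e1 i
  end.

Lemma zevalE e : zeval e = \sum_(i < size env) env`_i *~ zcoef e i.
Proof.
elim: e => [j||e1 IH1 e2 IH2|e1 IH1] /=.
- have [lt_j|le_j] := ltnP j (size env).
    rewrite (bigD1 (Ordinal lt_j)) //= eqxx big1 ?addr0 // => i.
    by rewrite -val_eqE /= => /negbTE->.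
  rewrite nth_default // big1 // => i _.
  by rewrite ltn_eqF // (leq_trans (ltn_ord i)).
- by rewrite big1 // => i _; rewrite mulr0z.
- by rewrite IH1 IH2 -big_split; apply: eq_bigr => i _; rewrite mulrzDr.
- by rewrite IH1 -sumrN; apply: eq_bigr => i _; rewrite mulrNz.
Qed.

Lemma zeval_eq e1 e2 :
  all (fun i => zcoef e1 i == zcoef e2 i) (iota 0 (size env)) ->
  zeval e1 = zeval e2.
Proof.
move=> /allP e12; rewrite !zevalE; apply: eq_bigr => i _.
by rewrite (eqP (e12 i _)) // mem_iota ltn_ord.
Qed.

End ZmoduleReflection.

Ltac zmod_index x env :=
  match env with
  | x :: _ => constr:(0%N)
  | _ :: ?env' => let n := zmod_index x env' in constr:(S n)
  end.

Ltac zmod_mem x env :=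
  match env with
  | nil => constr:(false)
  | x :: _ => constr:(true)
  | _ :: ?env' => zmod_mem x env'
  end.

Ltac zmod_atoms e env :=
  match e with
  | (?a + ?b)%R => let env' := zmod_atoms a env in zmod_atoms b env'
  | (- ?a)%R => zmod_atoms a env
  | 0%R => env
  | _ => match zmod_mem e env with
         | true => env
         | false => constr:(e :: env)
         end
  end.

Ltac zmod_quote e env :=
  match e with
  | (?a + ?b)%R =>
    let a' := zmod_quote a env in let b' := zmod_quote b env in
    constr:(ZAdd a' b')
  | (- ?a)%R => let a' := zmod_quote a env in constr:(ZOpp a')
  | 0%R => constr:(ZZero)
  | _ => let i := zmod_index e env in constr:(ZVar i)
  end.

Ltac zmod :=
  match goal with |- @eq ?V ?a ?b =>
    let env0 := zmod_atoms a (@nil V) in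
    let env := zmod_atoms b env0 in
    let a' := zmod_quote a env in
    let b' := zmod_quote b env in
    exact: (@zeval_eq _ env a' b' isT)
  end.

(** * Affine quandles *)

Section AffineQuandles.
Variables (G : zmodType) (T : {additive G -> G}) (T' : G -> G).
Hypotheses (TK : cancel T T') (T'K : cancel T' T).

(** The Alexander quandle of [G], seen as a module over [Z[T, T^-1]]. *)
Definition aff_mul x y := x - T x + T y.
Definition aff_ldiv x y := T' (y - x + T x).

Lemma aff_ldivK x y : aff_mul x (aff_ldiv x y) = y.
Proof. by rewrite /aff_mul /aff_ldiv T'K; zmod. Qed.
Lemma aff_mulK x y : aff_ldiv x (aff_mul x y) = y.
Proof.
rewrite /aff_mul /aff_ldiv -[in RHS](TK y); congr T'.
zmod.
Qed.
Lemma aff_mulxx x : aff_mul x x = x.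
Proof. by rewrite /aff_mul subrK. Qed.
Lemma aff_mulDr x y z :
  aff_mul x (aff_mul y z) = aff_mul (aff_mul x y) (aff_mul x z).
Proof.
rewrite /aff_mul !(raddfB T, raddfD T); zmod.
Qed.

Definition aff := Quandle aff_ldivK aff_mulK aff_mulxx aff_mulDr.

Lemma affE (x y : aff) : qmul x y = x - T x + T y. Proof. by []. Qed.

(** Terms are affine maps of their variables, so replacing [a] by [b] shifts the value by a constant
    [d] that does not depend on the other variables. *)
Lemma aff_abelian : abelian_quandle aff.
Proof.
move=> n t a b u v.
have T'D x y : T' (x + y) = T' x + T' y.
  by apply: (can_inj TK); rewrite raddfD !T'K.
have shift : exists d : G, forall w : 'I_n -> aff,
    qeval (assign b w) t = (qeval (assign a w) t : G) + d.
  elim: t => [[i|]|t1 [d1 IH1] t2 [d2 IH2]|t1 [d1 IH1] t2 [d2 IH2]] /=.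
  - by exists 0 => w; rewrite addr0.
  - by exists (b - a : G) => w; rewrite subrKC.
  - exists (d1 - T d1 + T d2) => w; rewrite IH1 IH2 /aff_mul.
    by rewrite !(raddfB T, raddfD T); zmod.
  - exists (T' (d2 - d1 + T d1)) => w; rewrite IH1 IH2 /aff_ldiv -T'D.
    by congr T'; rewrite !(raddfB T, raddfD T); zmod.
by case: shift => d dE tE; rewrite !dE tE.
Qed.

Lemma aff_congruence (H : G -> Prop) :
  H 0 -> (forall x y, H x -> H y -> H (x - y)) ->
  (forall x, H x -> H (T x)) -> (forall x, H x -> H (T' x)) ->
  congruence (fun x y : aff => H (x - y : G)).
Proof.
move=> H0 HB HT HT'.
have HN x : H x -> H (- x) by move=> Hx; rewrite -sub0r; apply: HB.
have HD x y : H x -> H y -> H (x + y).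
  by move=> Hx Hy; rewrite -[y]opprK; apply/HB/HN.
split.
- split=> [x|x y Hxy|x y z Hxy Hyz]; first by rewrite subrr.
    by rewrite -opprB; apply: HN.
  by rewrite -(subrK y x) -addrA; apply: HD.
- move=> x x' y y' Hx Hy.
  suff -> : (qmul (x : aff) y - qmul (x' : aff) y' : G) =
    (x - x') - T (x - x') + T (y - y') by apply/HD/HT/Hy/HB/HT/Hx.
  by rewrite !affE !(raddfB T); zmod.
- move=> x x' y y' Hx Hy.
  suff -> : (qldiv (x : aff) y - qldiv (x' : aff) y' : G) =
    T' ((y - y') - (x - x') + T (x - x')) by apply/HT'/HD/HT/Hx/HB/Hx.
  apply: (can_inj TK); rewrite (raddfB T) /= !T'K (raddfB T); zmod.
Qed.

End AffineQuandles.

(** * Kernels and the failure of distributivity *)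

Lemma pullback_congruence (P Q : quandle) (f : P -> Q) (R : Q -> Q -> Prop) :
  qhom f -> congruence R -> congruence (fun x y => R (f x) (f y)).
Proof.
move=> fM [[Rxx Rsym Rtrans] RM RD]; split.
- split=> [x|x y|x y z]; [exact: Rxx | exact: Rsym | exact: Rtrans].
- by move=> x x' y y'; rewrite !fM; apply: RM.
- by move=> x x' y y'; rewrite !(qhom_ldiv fM); apply: RD.
Qed.

Lemma eq_congruence (Q : quandle) : congruence (@eq Q).
Proof. by split=> [|x x' y y' -> ->|x x' y y' -> ->] //; split=> // x y z ->. Qed.

Lemma kernel_congruence (P Q : quandle) (f : P -> Q) :
  qhom f -> congruence (fun x y => f x = f y).
Proof. by move/pullback_congruence; apply; apply: eq_congruence. Qed.

(* The kernels of the two projections and of the addition [G * G -> G] have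
   trivial pairwise intersections and full pairwise joins. *)
Lemma aff_not_distributive (G : zmodType) (T : {additive G -> G}) T'
    (TK : cancel T T') (T'K : cancel T' T) (A := aff TK T'K) :
  nontrivial A -> ~ distributive_congruences (pair_quandle A A).
Proof.
move=> [x [y xNy]] dist.
pose fst' : pair_quandle A A -> A := fst.
pose snd' : pair_quandle A A -> A := snd.
pose add : pair_quandle A A -> A := fun z => ((z.1 : G) + (z.2 : G)).
have fstM : qhom fst' by [].
have sndM : qhom snd' by [].
have addM : qhom add.
  by move=> [a b] [c d]; rewrite /add /aff_mul /= /aff_mul !(raddfD T); zmod.
pose R f (u v : pair_quandle A A) := f u = f v :> A.
have [dst _] := dist (R fst') (R snd') (R add) (kernel_congruence fstM)
  (kernel_congruence sndM) (kernel_congruence addM)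
  (0 : G, 0 : G) (0 : G, (x : G) - y).
have /dst/(_ _ (eq_congruence _)) : cmeet (R fst') (cjoin (R snd') (R add))
    (0 : G, 0 : G) (0 : G, (x : G) - y).
  (* The point [(x - y, 0)] has the same second coordinate as [(0, 0)] and the same sum as
     [(0, x - y)]. *)
  split=> // E cE SE TE; case: cE => -[_ _ Etrans] _ _.
  apply: (Etrans _ ((x : G) - y, 0 : G)); first exact: SE.
  by apply: TE; rewrite /R /add /= addr0 add0r.
have fst_snd u v : cmeet (R fst') (R snd') u v -> u = v.
  by case: u v => [a b] [c d]; case; rewrite /R /fst' /snd' /= => -> ->.
have fst_add u v : cmeet (R fst') (R add) u v -> u = v.
  by case: u v => [a b] [c d]; case; rewrite /R /fst' /add /= => -> /addrI ->.
by move=> /(_ fst_snd fst_add) [/esym/eqP]; rewrite subr_eq0 => /eqP.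
Qed.

(** With [T = id] the product is [x - x + y = y]: this is the projection quandle. *)
Lemma aff_id_eval (G : zmodType) (X : Type) (TK : cancel (idfun : G -> G) idfun)
    (e : X -> aff (T := idfun) TK TK) t :
  qeval e t = e (rightmost t).
Proof.
by elim: t => //= t1 _ t2 ->; rewrite /aff_mul /aff_ldiv /=; zmod.
Qed.

(** * Ideals of integer polynomials and reduction modulo a prime *)

Section PrimeOfIdeal.
Variable I : {poly int} -> Prop.
Hypotheses (ID : forall f g, I f -> I g -> I (f + g))
  (IM : forall f g : {poly int}, I g -> I (f * g))
  (IX : forall f : {poly int}, I ('X * f) -> I f).

Let IB f g : I f -> I g -> I (f - g).
Proof. by move=> If Ig; apply: ID If _; rewrite -mulN1r; apply: IM. Qed.

Let IXn n f : I ('X^n * f) -> I f.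
Proof. by elim: n => [|n IH]; rewrite ?mul1r // exprS -mulrA => /IX. Qed.

Let pmod p (f : {poly int}) : {poly 'F_p} := map_poly (intr : int -> 'F_p) f.

Lemma dvdz_Fp p (c : int) : prime p -> ((c%:~R : 'F_p) == 0) = (p %| `|c|)%N.
Proof.
by move=> pr; rewrite -(dvdz_pcharf (pchar_Fp pr)).
Qed.

Let modp_one p k f : prime p -> pmod p ('X^k - p%:R * f) = 'X^k.
Proof.
move=> pr; rewrite /pmod rmorphB rmorphM /= map_polyXn rmorph_nat.
have -> : (p%:R : {poly 'F_p}) = 0.
  by rewrite -polyC_natr pchar_Fp_0.
by rewrite mul0r subr0.
Qed.

(* Otherwise every prime divides a power of [X] modulo [I].  Modulo a prime not
   dividing its extreme coefficients, an element [g] of least degree in [I]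
   then divides a power of [X], hence [g] is an integer; and its prime factors
   can be removed one after the other. *)
Lemma prime_of_ideal : (exists h, I h /\ h != 0) -> ~ I 1 ->
  exists p, prime p /\ forall k (f : {poly int}), ~ I ('X^k - p%:R * f).
Proof.
move=> [h [Ih h_nz]] I1.
apply: contrapT => noP.
have allP p : prime p -> exists k (f : {poly int}), I ('X^k - p%:R * f).
  move=> pr; apply: contrapT => nop; apply: noP; exists p; split=> // k f Ikf.
  by apply: nop; exists k, f.
(* Strong induction on [D]: if a prime [q] divides [D] and [X^k - q f] is in [I], then so is
   [(D/q) X^k], and cancelling [X^k] leaves the smaller integer [D/q]. *)
have noZ D : (0 < D)%N -> ~ I D%:R.
  have [n] := ubnP D; elim: n D => // n IH D ltD D_gt0 ID'.
  have [D_le1|D_gt1] := leqP D 1.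
    by apply: I1; rewrite -[1](_ : D%:R = _) // (_ : D = 1%N) //; lia.
  have pr := pdiv_prime D_gt1; have pD := pdiv_dvd D.
  have [k [f Ikf]] := allP _ pr.
  have D'_gt0 : (0 < D %/ pdiv D)%N by rewrite divn_gt0 ?pdiv_gt0 // dvdn_leq.
  apply: (IH (D %/ pdiv D)%N) => //.
    by rewrite (leq_trans _ (ltD : (D <= n)%N)) // ltn_Pdiv ?prime_gt1.
  apply: (@IXn k).
  rewrite (_ : _ * _ = (D %/ pdiv D)%:R * ('X^k - (pdiv D)%:R * f) + f * D%:R).
    by apply: ID; apply: IM.
  have -> : D%:R = (D %/ pdiv D)%:R * (pdiv D)%:R :> {poly int}.
    by rewrite -natrM divnK.
  by ring.
pose P n := `[< exists g, [/\ I g, g != 0 & size g = n] >].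
have exP : exists n, P n by exists (size h); apply/asboolP; exists h.
case: (ex_minnP exP) => n /asboolP[g [Ig g_nz gn]] minP.
(* If the constant coefficient vanished, dividing by [X] would give a shorter element of [I]. *)
have g0_nz : g`_0 != 0.
  apply/negP => /eqP g0.
  have gE : g = 'X * drop_poly 1 g.
    apply/polyP => -[|i]; first by rewrite coefXM.
    by rewrite coefXM /= coef_drop_poly addn1.
  have sg : size (drop_poly 1 g) = (size g).-1.
    by rewrite size_drop_poly subn1.
  have : (size g <= (size g).-1)%N.
    rewrite {1}gn; apply: minP; apply/asboolP; exists (drop_poly 1 g).
    split=> //; first by apply: IX; rewrite -gE.
    by apply: contraNneq g_nz => d0; rewrite gE d0 mulr0.
  by rewrite leqNgt ltn_predL lt0n size_poly_eq0 g_nz.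
set l := lead_coef g.
have l_nz : l != 0 by rewrite lead_coef_eq0.
(* The remainder of the pseudo-division of [u] by [g] lies in [I] and is shorter than [g], hence
   zero. *)
have Ig_dvd u : I u -> exists j (v : {poly int}), l ^+ j *: u = v * g.
  move=> Iu; exists (scalp u g), (u %/ g); have := Pdiv.Idomain.divp_eq u g.
  move=> uE; rewrite uE [u %% g](_ : _ = 0) ?addr0 //.
  apply/eqP/contraT => r_nz; have := Pdiv.Idomain.ltn_modp u g.
  rewrite g_nz ltnNge gn minP //; apply/asboolP; exists (u %% g); split=> //.
  have -> : u %% g = (lead_coef g ^+ scalp u g)%:P * u - u %/ g * g.
    by rewrite mul_polyC uE addrC addKr.
  by apply: IB; apply: IM.
(* Such a prime divides neither extreme coefficient of [g]: reduction modulo [q] keeps the degree,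
   and 0 is not a root. *)
have [q q_gt q_pr] := prime_above `|l * g`_0|.
have Fq_nz c : (c %| l * g`_0)%Z -> (c%:~R : 'F_q) != 0.
  rewrite /dvdz dvdz_Fp // => c_dvd; apply: contraTN q_gt => q_c.
  rewrite -leqNgt dvdn_leq ?(dvdn_trans q_c) //.
  by rewrite absz_gt0 mulf_neq0.
have [k [f Ikf]] := allP _ q_pr.
have [j [v vE]] := Ig_dvd _ Ikf.
have ql_nz : (l%:~R : 'F_q) != 0 by apply: Fq_nz; apply: dvdz_mulr.
have qsize : size (pmod q g) = size g by rewrite size_map_poly_id0.
have q_dvd : pmod q g %| ('X - 0%:P) ^+ k.
  have vqE : (l%:~R ^+ j : 'F_q) *: 'X^k = pmod q v * pmod q g.
    rewrite -(modp_one k f q_pr) -rmorphXn -map_polyZ vE.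
    by rewrite /pmod rmorphM.
  rewrite subr0 -(dvdpZr _ _ (expf_neq0 j ql_nz)) vqE.
  exact: dvdp_mull.
(* Modulo [q], [g] is thus associated to some [X^i]; its nonzero constant coefficient forces
   [i = 0], so [g] is an integer. *)
have [i _ qi] := dvdp_exp_XsubCP q_dvd.
have i0 : i = 0%N.
  apply: contraNeq (Fq_nz g`_0 (dvdz_mull _ (dvdzz _))) => i_nz.
  rewrite -coef_map -horner_coef0 -/(root _ _) (eqp_root qi) /root.
  by rewrite horner_exp hornerXsubC subrr expr0n (negbTE i_nz).
have sg1 : (size g <= 1)%N by rewrite -qsize (eqp_size qi) i0 size_exp_XsubC.
suff: I (absz g`_0)%:R by apply: noZ; rewrite absz_gt0.
rewrite -polyC_natr natz abszE normrEsg polyCM.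
by apply: IM; rewrite -size1_polyC.
Qed.
End PrimeOfIdeal.

Lemma pmod_eq0 p (f : {poly int}) : prime p ->
  map_poly (intr : int -> 'F_p) f = 0 -> exists r : {poly int}, f = p%:R * r.
Proof.
move=> pr f0; exists (\poly_(j < size f) (f`_j %/ p)%Z).
apply/polyP => j; rewrite -polyC_natr mulrC coefMC coef_poly.
case: ltnP => [_|/(nth_default 0)->]; last by rewrite mul0r.
rewrite natz divzK //; have := congr1 (fun g : {poly 'F_p} => g`_j) f0.
by rewrite coef_map coef0 /= => /eqP; rewrite dvdz_Fp.
Qed.

Lemma pmod_surj p (g : {poly 'F_p}) : prime p ->
  exists f : {poly int}, map_poly (intr : int -> 'F_p) f = g.
Proof.
move=> pr; exists (\poly_(j < size g) Posz (g`_j : 'F_p)%R).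
apply/polyP => j; rewrite coef_map coef_poly /=.
case: ltnP => [_|/(nth_default 0)->] //.
by rewrite -pmulrn natr_Zp.
Qed.

(** The remainders of the powers of [X] modulo [h] over [F_p] lie in a finite space, so two of them
    coincide by the pigeonhole principle; the resulting divisibility is lifted to the integers. *)
Lemma X_order_mod p (h : {poly int}) : prime p ->
  map_poly (intr : int -> 'F_p) h != 0 ->
  exists n i (u r : {poly int}),
    (0 < n)%N /\ 'X^i * ('X^n - 1) = u * h + p%:R * r.
Proof.
move=> pr; set hp := map_poly _ h => hp_nz.
pose d := size hp; pose N := #|{: 'rV['F_p]_d}|.+1.
pose F (i : 'I_N) := poly_rV ('X^i %% hp) : 'rV['F_p]_d.
have /injectivePn[i [j]] : ~~ injectiveb F.
  by apply/negP => /injectiveP/leq_card; rewrite card_ord ltnn.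
wlog lt_ij : i j / (i < j)%N.
  move=> wl ij Fij; have := ij; rewrite -val_eqE neq_ltn => /orP[lt|lt].
    exact: (wl i j).
  by apply: (wl j i); rewrite // eq_sym.
move=> _ Fij; exists (j - i)%N, (val i).
have size_mod k : (size ('X^k %% hp)%R <= d)%N.
  by rewrite ltnW // ltn_modp.
have mod_ij : 'X^i %% hp = 'X^j %% hp.
  by rewrite -(poly_rV_K (size_mod i)) -(poly_rV_K (size_mod j)) -/(F i) Fij.
have /dvdpP[v vE] : hp %| 'X^i * ('X^(j - i) - 1).
  rewrite mulrBr mulr1 -exprD subnKC 1?ltnW // /dvdp modpD modpN mod_ij.
  by rewrite subrr.
have [u uE] := pmod_surj v pr.
have [|r rE] := @pmod_eq0 p ('X^i * ('X^(j - i) - 1) - u * h) pr.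
  rewrite rmorphB !rmorphM /= rmorphB rmorph1 !map_polyXn uE -/hp -vE.
  by rewrite /= map_polyXn subrr.
exists u, r; rewrite subn_gt0 lt_ij; split=> //.
by rewrite -rE subrKC.
Qed.

(** * Abelian groups with an endomorphism as [Z[X]]-modules *)

Section PolynomialAction.
Variables (G : zmodType) (T : {additive G -> G}).
Implicit Types (f g : {poly int}) (b : G).

(** The endomorphism [f(T)] applied to [b]. *)
Definition pact f b : G := \sum_(i < size f) iter i T b *~ f`_i.

Lemma pactE N f b : (size f <= N)%N ->
  pact f b = \sum_(i < N) iter i T b *~ f`_i.
Proof.
move=> leN; rewrite /pact (big_ord_widen _ (fun i => iter i T b *~ f`_i) leN).
rewrite big_mkcond; apply: eq_bigr => i _.
by case: ltnP => // /(nth_default 0) ->; rewrite mulr0z.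
Qed.

Lemma pactD f g b : pact (f + g) b = pact f b + pact g b.
Proof.
pose N := maxn (size f) (size g).
rewrite !(@pactE N) ?leq_maxl ?leq_maxr ?size_polyD // -big_split.
by apply: eq_bigr => i _; rewrite coefD mulrzDr.
Qed.

Lemma pactCM c f b : pact (c%:P * f) b = pact f b *~ c.
Proof.
rewrite !(@pactE (size f)) //; last first.
  by rewrite mul_polyC size_scale_leq.
rewrite mulrz_suml; apply: eq_bigr => i _.
by rewrite coefCM mulrC mulrzA.
Qed.

Lemma pactN f b : pact (- f) b = - pact f b.
Proof. by rewrite -mulN1r -polyC1 -polyCN pactCM mulrN1z. Qed.

Lemma pactB f g b : pact (f - g) b = pact f b - pact g b.
Proof. by rewrite pactD pactN. Qed.

Lemma pact1 b : pact 1 b = b.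
Proof. by rewrite (@pactE 1) ?size_poly1 // big_ord1 coef1 mulr1z. Qed.

Lemma pactC c b : pact c%:P b = b *~ c.
Proof. by rewrite -[c%:P]mulr1 pactCM pact1. Qed.

Lemma pactMX f b : pact (f * 'X) b = pact f (T b).
Proof.
rewrite (@pactE (size f).+1); last first.
  have [->|f_nz] := eqVneq f 0; first by rewrite mul0r size_poly0.
  by rewrite size_mulX.
rewrite big_ord_recl coefMX mulr0z add0r; apply: eq_bigr => i _.
by rewrite coefMX /= -iterSr.
Qed.

Lemma pactXM f b : pact ('X * f) b = T (pact f b).
Proof.
rewrite mulrC pactMX raddf_sum; apply: eq_bigr => i _.
by rewrite raddfMz -iterS -iterSr.
Qed.

Lemma pactM f g b : pact (f * g) b = pact f (pact g b).
Proof.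
elim/poly_ind: f g b => [|f c IH] g b.
  by rewrite mul0r /pact size_poly0 !big_ord0.
by rewrite mulrDl !pactD pactCM pactC pactMX -pactXM -IH mulrA.
Qed.

Lemma pactXn n b : pact 'X^n b = iter n T b.
Proof. by elim: n => [|n IH]; rewrite ?pact1 // exprS pactXM IH. Qed.

Lemma pact_nat n b : pact n%:R b = b *+ n.
Proof. by rewrite -polyC_natr pactC pmulrn natz. Qed.

Lemma pact0r f : pact f 0 = 0.
Proof.
have iter0 i : iter i T 0 = 0 by elim: i => //= i ->; rewrite raddf0.
by rewrite /pact big1 // => i _; rewrite iter0 mul0rz.
Qed.

Lemma pactDr f b c : pact f (b + c) = pact f b + pact f c.
Proof.
have iterD i : iter i T (b + c) = iter i T b + iter i T c.
  by elim: i => //= i ->; rewrite raddfD.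
rewrite /pact -big_split; apply: eq_bigr => i _.
by rewrite iterD mulrzDl.
Qed.

Lemma pactBr f b c : pact f (b - c) = pact f b - pact f c.
Proof. by apply: (addIr (pact f c)); rewrite subrK -pactDr subrK. Qed.

Lemma pactX b : pact 'X b = T b.
Proof. by rewrite -['X]mulr1 pactXM pact1. Qed.

End PolynomialAction.

(** * Finite quotients of affine quandles *)

Section AffineFinite.
Variables (G : zmodType) (T : {additive G -> G}) (T' : G -> G).
Hypotheses (TK : cancel T T') (T'K : cancel T' T).
Let A := aff TK T'K.

(** The coefficient of [v] in [t] is a Laurent polynomial in [T]; the factor [T^k] clears the
    inverse powers brought in by divisions. At [T = 1] the quandle degenerates to a projection, so
    [f(1)] only detects the rightmost variable. *)
Lemma aff_coef (v : nat) (t : qterm nat) : exists k (f : {poly int}),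
  f.[1] = (rightmost t == v)%:R /\ forall b : G,
  iter k T (@qeval nat A (fun n => if n == v then b else 0) t) = pact T f b.
Proof.
elim: t => [n|t1 [k1 [f1 [E1 H1]]] t2 [k2 [f2 [E2 H2]]]
             |t1 [k1 [f1 [E1 H1]]] t2 [k2 [f2 [E2 H2]]]] /=.
- exists 0%N, (n == v)%:R; split=> [|b]; first by rewrite -polyC_natr hornerC.
  by rewrite pact_nat /=; case: eqP; rewrite ?mulr1n ?mulr0n.
- exists (k1 + k2)%N, ('X^k2 * (1 - 'X) * f1 + 'X^k1 * 'X * f2); split.
    by rewrite hornerD !hornerM !hornerXn hornerD hornerN hornerX hornerC
      subrr !expr1n !mul1r mul0r add0r E2.
  move=> b; rewrite -pactXn pactD !pactM -H1 -H2.
  set v1 := @qeval _ A _ t1; set v2 := @qeval _ A _ t2.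
  have -> : aff_mul T v1 v2 = pact T (1 - 'X) v1 + pact T 'X v2.
    by rewrite pactB !pactX pact1.
  rewrite -!pactXn -!pactM pactDr -!pactM.
  by congr (pact _ _ _ + pact _ _ _); rewrite exprD; ring.
- exists (k1 + k2).+1, ('X^k1 * f2 - 'X^k2 * (1 - 'X) * f1); split.
    by rewrite hornerD hornerN !hornerM !hornerXn hornerD hornerN hornerX hornerC
      subrr !expr1n !mul1r mul0r subr0 E2.
  move=> b; rewrite iterSr /aff_ldiv T'K -pactXn pactB !pactM -H1 -H2.
  set v1 := @qeval _ A _ t1; set v2 := @qeval _ A _ t2.
  have -> : v2 - v1 + T v1 = v2 + pact T ('X - 1) v1.
    by rewrite pactB pactX pact1; zmod.
  rewrite -!pactXn -!pactM pactDr -pactM -pactN.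
  by congr (pact _ _ _ + pact _ _ _); rewrite exprD; ring.
Qed.

(** Both sides of the identity have the same coefficient at the rightmost variable of [s], as maps
    on [G], while the polynomials take the values 1 and 0 at 1. The difference of the two, over a
    common denominator, is [h]. *)
Lemma aff_annihilator (s r : qterm nat) :
  rightmost s <> rightmost r -> satisfies A s r ->
  exists h : {poly int}, h.[1] = 1 /\ forall b, pact T h b = 0.
Proof.
move=> /eqP srN sr.
have [k [f [Ef Hf]]] := aff_coef (rightmost s) s.
have [l [g [Eg Hg]]] := aff_coef (rightmost s) r.
exists ('X^l * f - 'X^k * g); split.
  rewrite hornerD hornerN !hornerM !hornerXn !expr1n !mul1r Ef Eg eqxx.
  by rewrite eq_sym (negbTE srN) subr0.
move=> b; rewrite pactB !pactM -Hf -Hg sr -!pactXn -!pactM mulrC.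
exact: subrr.
Qed.


Section CyclicQuotient.
Variables (a : G) (h : {poly int}) (p : nat).
Hypotheses (h1 : h.[1] = 1) (h0 : forall b, pact T h b = 0) (p_pr : prime p).
Hypothesis ap : forall k f, pact T ('X^k - p%:R * f) a <> 0.

(** The [Z[T, T^-1]]-submodule generated by [a]. The finite quandle will be [M / pM]. *)
Let M (x : G) := exists k f, pact T 'X^k x = pact T f a.
Let pM (x : G) := exists m, M m /\ x = m *+ p.

Let iterI k : injective (pact T 'X^k).
Proof.
move=> x y; rewrite !pactXn.
by elim: k => //= k IH /(can_inj TK).
Qed.

Let M_pact x f : M x -> M (pact T f x).
Proof.
by move=> [k [g E]]; exists k, (f * g); rewrite -pactM (mulrC 'X^k) !pactM E.
Qed.

Let MD x y : M x -> M y -> M (x + y).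
Proof.
move=> [k [f E]] [l [g F]]; exists (k + l)%N, ('X^l * f + 'X^k * g).
rewrite pactDr pactD !pactM -E -F -!pactM.
by congr (pact _ _ _ + pact _ _ _); rewrite exprD // mulrC.
Qed.

Let MB x y : M x -> M y -> M (x - y).
Proof.
by move=> Mx My; apply: MD Mx _; rewrite -[y](pact1 T) -pactN; apply: M_pact.
Qed.

Let MT x : M x -> M (T x). Proof. by rewrite -pactX; apply: M_pact. Qed.

Let MT' x : M x -> M (T' x).
Proof.
move=> [k [f E]]; exists k.+1, f; by rewrite exprSr pactM pactX T'K.
Qed.

Let Ma : M a. Proof. by exists 0%N, 1. Qed.
Let M0 : M 0. Proof. by exists 0%N, 0%:P; rewrite pact0r pactC. Qed.

Let T'n x n : T' (x *+ n) = T' x *+ n.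
Proof. by apply: (can_inj TK); rewrite (raddfMn T) !T'K. Qed.

Let pM0 : pM 0. Proof. by exists 0; rewrite mul0rn. Qed.
Let pMB x y : pM x -> pM y -> pM (x - y).
Proof.
move=> [m [Mm ->]] [n [Mn ->]]; exists (m - n).
by rewrite mulrnBl; split=> //; apply: MB.
Qed.
Let pMD x y : pM x -> pM y -> pM (x + y).
Proof.
by move=> px py; rewrite -[y]opprK -[- y]sub0r; apply/pMB/pMB.
Qed.
Let pMT x : pM x -> pM (T x).
Proof.
by move=> [m [Mm ->]]; exists (T m); rewrite (raddfMn T); split=> //; apply: MT.
Qed.
Let pMT' x : pM x -> pM (T' x).
Proof. by move=> [m [Mm ->]]; exists (T' m); rewrite T'n; split=> //; apply: MT'. Qed.
Let pM_pact x f : pM x -> pM (pact T f x).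
Proof.
move=> [m [Mm ->]]; exists (pact T f m); split; first exact: M_pact.
by rewrite -!(pact_nat T) -!pactM mulrC.
Qed.

(** Since [h(1) = 1], [h] is nonzero modulo [p]. As [h] kills [G], [T^i (T^n - 1)] acts as a
    multiple of [p], and [T^i] can be cancelled inside [M]: [T^n] is the identity on [M / pM]. *)
Let period : exists n, (0 < n)%N /\ forall x, M x -> pM (pact T ('X^n - 1) x).
Proof.
have [|n [i [u [r [n_gt0 E]]]]] := @X_order_mod p h p_pr.
  apply/eqP => hp.
  have /eqP : (h.[1])%:~R = 0 :> 'F_p by rewrite -horner_map hp horner0.
  by rewrite h1 dvdz_Fp // Euclid_dvd1.
exists n; split=> // x Mx.
pose m := iter i T' (pact T r x).
have Em : pact T 'X^i m = pact T r x.
  rewrite /m pactXn; by elim: (i) => //= k IH; rewrite -iterS iterSr T'K.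
exists m; split.
  by rewrite /m; elim: (i) => [|k IH]; [apply: M_pact | apply: MT'].
apply: (@iterI i); rewrite -pactM E pactD !pactM h0 pact0r add0r.
by rewrite -(pact_nat T) -[RHS]pactM (mulrC 'X^i) !pactM Em.
Qed.

(** Modulo [pM], [x] equals [T^n x], so an inverse of [T] can be traded for the power [T^(n-1)];
    induction on the number [k] of inverses. *)
Let class_poly n x : (0 < n)%N -> (forall x, M x -> pM (pact T ('X^n - 1) x)) ->
  M x -> exists g, pM (x - pact T g a).
Proof.
case: n => // n _ per [k]; elim: k x => [|k IH] x [f E].
  by exists f; rewrite -E pact1 subrr.
have Mx : M x by exists k.+1, f.
have [|g pg] := IH (T x); first by exists f; rewrite -pactX -pactM -exprSr.
exists ('X^n * g).
have -> : x - pact T ('X^n * g) a =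
    pact T 'X^n (T x - pact T g a) - pact T ('X^(n.+1) - 1) x.
  rewrite pactBr pactB pact1 exprSr !pactM pactX.
  by set u := pact T 'X^n (T x); set w := pact T 'X^n _; zmod.
by apply: pMB; [apply: pM_pact | apply: per].
Qed.

(** The polynomial from [class_poly] is reduced modulo [X^n - 1], then its coefficients modulo [p].
    The type ['I_p.+1], with one value to spare, is what [inord] needs. *)
Let class_small n x : (0 < n)%N -> (forall x, M x -> pM (pact T ('X^n - 1) x)) ->
  M x -> exists c : {ffun 'I_n -> 'I_p.+1},
    pM (x - pact T (\sum_(j < n) Posz (c j) *: 'X^j) a).
Proof.
move=> n_gt0 per Mx; have [g pg] := class_poly n_gt0 per Mx.
pose d : {poly int} := 'X^n - 1%:P; pose rho := g %% d; pose q := g %/ d.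
have gE : g = q * d + rho by apply/Pdiv.IdomainMonic.divp_eq/monicXnsubC.
have rho_size : (size rho <= n)%N.
  by rewrite -ltnS -(size_XnsubC (1 : int) n_gt0) ltn_modp -size_poly_gt0 size_XnsubC.
exists [ffun j : 'I_n => inord `|(rho`_j %% p)%Z|].
have -> : \sum_(j < n)
      Posz ([ffun j : 'I_n => inord `|(rho`_j %% p)%Z|] j : 'I_p.+1) *: 'X^j
    = \poly_(j < n) (rho`_j %% p)%Z :> {poly int}.
  rewrite poly_def; apply: eq_bigr => j _; rewrite ffunE.
  have p_nz : p%:Z != 0 by rewrite eqz_nat -lt0n prime_gt0.
  rewrite inordK ?gez0_abs ?modz_ge0 // ltnS ltnW // -ltz_nat.
  by rewrite gez0_abs ?modz_ge0 // ltz_pmod // ltz_nat prime_gt0.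
set rho0 := \poly_(j < n) _; pose rho1 := \poly_(j < n) (rho`_j %/ p)%Z.
have rhoE : rho = rho0 + p%:R * rho1.
  apply/polyP => j; rewrite coefD -polyC_natr mulrC coefMC !coef_poly.
  case: ltnP => [_|le_nj]; first by rewrite natz addrC -divz_eq.
  by rewrite nth_default ?mul0r // (leq_trans rho_size).
have ga : pact T g a =
    pact T d (pact T q a) + (pact T rho0 a + pact T rho1 a *+ p).
  have -> : pact T g a = pact T (d * q + rho) a by rewrite mulrC -gE.
  by rewrite [LHS]pactD rhoE (pactD _ rho0) !pactM pact_nat.
have -> : x - pact T rho0 a =
    (x - pact T g a) + (pact T d (pact T q a) + pact T rho1 a *+ p).
  by rewrite ga; set u := pact T d _; set v := pact T rho0 a; zmod.
apply: pMD pg _; apply: pMD; first by apply/per/M_pact.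
by exists (pact T rho1 a); split=> //; apply: M_pact.
Qed.

Let SM x y : M x -> M y -> M (qmul (x : A) (y : A)).
Proof. by move=> Mx My; apply: MD; [apply/MB/MT | apply: MT]. Qed.
Let SD x y : M x -> M y -> M (qldiv (x : A) (y : A)).
Proof. by move=> Mx My; apply/MT'/MD/MT/Mx/MB. Qed.
Let S := @sub_quandle A M SM SD.
Let R (x y : S) := pM ((proj1_sig x : G) - proj1_sig y).

Let cR : congruence R.
Proof.
exact: (@pullback_congruence S A (@proj1_sig _ M) _ (fun _ _ => erefl)
  (aff_congruence TK T'K pM0 pMB pMT pMT')).
Qed.

Let quotient := quot_quandle cR.

(** In [M / pM] the class of [a] is nonzero by [ap], and [class_small] bounds the number of
    classes. *)
Lemma cyclic_quotient V : variety V -> V A ->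
  exists Q, V Q /\ nontrivial Q /\ finite_quandle Q.
Proof.
move=> vV VA; exists quotient; split.
  by apply: variety_quot => //; apply: variety_sub.
split.
  exists (quot_pi R (exist M a Ma)), (quot_pi R (exist M 0 M0)).
  move=> /(quot_piP cR)[m [[k [f E]]]] /=; rewrite subr0 => am.
  apply: (ap (k := k) (f := f)).
  by rewrite pactB pactM -E -pactM (mulrC p%:R) pactM pact_nat -am subrr.
have [n [n_gt0 per]] := period.
pose F (c : {ffun 'I_n -> 'I_p.+1}) : quotient :=
  quot_pi R (exist M _ (M_pact (\sum_(j < n) Posz (c j) *: 'X^j) Ma)).
apply: (@sub_finite_set _ _ (range F)); last exact: finite_image.
move=> B _; have [c pMc] := class_small n_gt0 per (proj2_sig (quot_repr B)).
by exists c => //; rewrite -[RHS](quot_reprK B); apply/esym/quot_piP.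
Qed.

End CyclicQuotient.

(** The ideal is the annihilator of a nonzero difference [a]; it is closed under cancelling [X]
    because [T] is injective. *)
Lemma aff_finite V s r : variety V -> rightmost s <> rightmost r ->
  satisfies A s r -> V A -> nontrivial A ->
  exists Q, V Q /\ nontrivial Q /\ finite_quandle Q.
Proof.
move=> vV srN sr VA [x [y xNy]].
have [h [h1 h0]] := aff_annihilator srN sr.
pose a : G := (x : G) - y; pose I f := pact T f a = 0.
have [|||||p [p_pr ap]] := @prime_of_ideal I.
- by move=> f g If Ig; rewrite /I pactD If Ig addr0.
- by move=> f g Ig; rewrite /I pactM Ig pact0r.
- by move=> f If; apply: (can_inj TK); rewrite -pactXM If (raddf0 T).
- exists h; split; first by rewrite /I h0.
  by apply/eqP => h_eq0; move: h1; rewrite h_eq0 horner0 => /esym/eqP; rewrite oner_eq0.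
- by rewrite /I pact1 => /eqP; rewrite subr_eq0 => /eqP.
exact: (cyclic_quotient h1 h0 p_pr ap vV VA).
Qed.

End AffineFinite.

(** * Mal'cev operations and the affine structure of medial quandles *)

Section MalcevOperation.
Variables (V : quandle -> Prop) (p : forall Q : quandle, Q -> Q -> Q -> Q).
Hypothesis pV : malcev V p.

Lemma malcev_hom (P Q : quandle) (f : P -> Q) x y z :
  qhom f -> f (p x y z) = p (f x) (f y) (f z).
Proof. by case: pV => + _; apply. Qed.

Lemma malcev_l (Q : quandle) (x y : Q) : V Q -> p x y y = x.
Proof. by case: pV => _ /[apply] /(_ x y)[]. Qed.

Lemma malcev_r (Q : quandle) (x y : Q) : V Q -> p x x y = y.
Proof. by case: pV => _ /[apply] /(_ x y)[]. Qed.

Lemma malcev_pair (P Q : quandle) (x y z : pair_quandle P Q) :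
  p x y z = (p x.1 y.1 z.1, p x.2 y.2 z.2).
Proof.
rewrite [LHS]surjective_pairing; congr pair.
  exact: (@malcev_hom (pair_quandle P Q) P fst).
exact: (@malcev_hom (pair_quandle P Q) Q snd).
Qed.

Lemma malcev_congruence (Q : quandle) (R : Q -> Q -> Prop) x x' y y' z z' :
  congruence R -> R x x' -> R y y' -> R z z' -> R (p x y z) (p x' y' z').
Proof.
move=> cR /(quot_piP cR) Rx /(quot_piP cR) Ry /(quot_piP cR) Rz.
apply/(quot_piP cR); have piM := quot_pi_hom cR.
by rewrite !(malcev_hom _ _ _ piM) Rx Ry Rz.
Qed.

Section Medial.
Variable Q : quandle.
Hypotheses (VQ : V Q) (medQ : medial Q).

(** Mediality says that multiplication is a homomorphism from [Q * Q] to [Q], and [p] commutes with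
    homomorphisms. *)
Lemma malcev_mul (x x' y y' z z' : Q) :
  p (qmul x x') (qmul y y') (qmul z z') = qmul (p x y z) (p x' y' z').
Proof.
pose f (u : pair_quandle Q Q) := qmul u.1 u.2.
have fM : qhom f by move=> u v; apply: medQ.
rewrite -[RHS]/(f (p x y z, p x' y' z')) -!/(f (_, _)).
by rewrite -(@malcev_hom _ Q f (x, x') (y, y') (z, z') fM) malcev_pair.
Qed.

(** By [malcev_mul], [p] is itself a homomorphism from [Q^3] to [Q], so it commutes with itself. *)
Lemma malcev_malcev (x x' x'' y y' y'' z z' z'' : Q) :
  p (p x x' x'') (p y y' y'') (p z z' z'') =
  p (p x y z) (p x' y' z') (p x'' y'' z'').
Proof.
pose f (u : pair_quandle (pair_quandle Q Q) Q) := p u.1.1 u.1.2 u.2.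
have fM : qhom f by move=> u v; apply: malcev_mul.
have := @malcev_hom _ Q f (x, x', x'') (y, y', y'') (z, z', z'') fM.
by rewrite !malcev_pair.
Qed.

Lemma medial_affine (o : Q) :
  exists (G : zmodType) (T : {additive G -> G}) (T' : G -> G)
    (TK : cancel T T') (T'K : cancel T' T) (f : aff TK T'K -> Q),
    qhom f /\ bijective f.
Proof.
(* A [zmodType] requires a choice structure, which is taken classically. The group laws then follow
   from [malcev_malcev] with [o] in suitable places. *)
pose C : choiceType := {classic Q}.
pose add (x y : C) : C := p (x : Q) o y.
pose opp (x : C) : C := p o (x : Q) o.
have addA : associative add.
  move=> x y z; have := malcev_malcev x o y o o o o o z.
  by rewrite !malcev_l // !malcev_r.
have addC : commutative add.
  move=> x y; have := malcev_malcev o o x o o o y o o.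
  by rewrite !malcev_l // !malcev_r.
have add0 : left_id (o : C) add by move=> x; apply: malcev_r.
have addN : left_inverse (o : C) opp add.
  move=> x; have := malcev_malcev o x o o o o o o x.
  by rewrite !malcev_l // !malcev_r // malcev_l.
pose G : zmodType := HB.pack C (GRing.isZmodule.Build C addA addC add0 addN).
pose T0 (x : G) : G := qmul o (x : Q).
pose T' (x : G) : G := qldiv o (x : Q).
have T0D (x y : G) : T0 (x + y) = T0 x + T0 y.
  rewrite /T0; have := malcev_mul o x o o o y.
  by rewrite qmulxx malcev_l // => <-.
have T0B : zmod_morphism T0.
  by move=> x y; apply: (addIr (T0 y)); rewrite -T0D !subrK.
pose T : {additive G -> G} := HB.pack T0 (GRing.isZmodMorphism.Build G G T0 T0B).
have TK : cancel T T' by move=> x; apply: qmulK.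
have T'K : cancel T' T by move=> x; apply: qldivK.
exists G, T, T', TK, T'K, id; split; last by exists id.
(* It remains to identify [x * o] with [x - T x], which is the case [y = x] by idempotence. *)
have mulE (x y : G) : qmul (x : Q) y = (qmul (x : Q) o : G) + T y.
  have := malcev_mul x o o o o y.
  by rewrite qmulxx malcev_l // malcev_r.
move=> x y; rewrite mulE; congr (_ + _ : G).
by apply: (addIr (T x)); rewrite -mulE qmulxx subrK.
Qed.

End Medial.
End MalcevOperation.

(** * Congruence lattices and the commutator *)

Lemma cmeet_congruence (Q : quandle) (R S : Q -> Q -> Prop) :
  congruence R -> congruence S -> congruence (cmeet R S).
Proof.
move=> [[R1 R2 R3] RM RD] [[S1 S2 S3] SM SD]; split; first split.
- by move=> x; split; [apply: R1 | apply: S1].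
- by move=> x y [Rxy Sxy]; split; [apply: R2 | apply: S2].
- by move=> x y z [Rxy Sxy] [Ryz Syz]; split; [apply: (R3 _ y)|apply: (S3 _ y)].
- by move=> x x' y y' [Rx Sx] [Ry Sy]; split; [apply: RM | apply: SM].
- by move=> x x' y y' [Rx Sx] [Ry Sy]; split; [apply: RD | apply: SD].
Qed.

Lemma cjoin_congruence (Q : quandle) (R S : Q -> Q -> Prop) :
  congruence (cjoin R S).
Proof.
split; first split.
- by move=> x T [[T1 T2 T3] TM TD] RT ST; apply: T1.
- move=> x y E T cT RT ST; case: (cT) => -[T1 T2 T3] _ _.
  exact: T2 (E T cT RT ST).
- move=> x y z E F T cT RT ST; case: (cT) => -[T1 T2 T3] _ _.
  exact: T3 (E T cT RT ST) (F T cT RT ST).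
- move=> x x' y y' E F T cT RT ST; case: (cT) => _ TM _.
  exact: TM (E T cT RT ST) (F T cT RT ST).
- move=> x x' y y' E F T cT RT ST; case: (cT) => _ _ TD.
  exact: TD (E T cT RT ST) (F T cT RT ST).
Qed.

Section Commutator.
Variables (V : quandle -> Prop) (p : forall Q : quandle, Q -> Q -> Q -> Q).
Hypotheses (vV : variety V) (pV : malcev V p).
Variable Q : quandle.
Hypothesis VQ : V Q.
Implicit Types R S T N : Q -> Q -> Prop.

(** Congruences permute in the presence of a Mal'cev term, the new middle point being [p x c y]. *)
Lemma comp_congruence S T : congruence S -> congruence T ->
  congruence (fun x y => exists2 c, S x c & T c y).
Proof.
move=> cS cT; have Sp x x' y y' z z' := @malcev_congruence V p pV Q S x x' y y' z z' cS.
have Tp x x' y y' z z' := @malcev_congruence V p pV Q T x x' y y' z z' cT.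
case: (cS) (cT) => [[S1 S2 S3] SM SD] [[T1 T2 T3] TM TD].
have swap x c y : T x c -> S c y -> exists2 d, S x d & T d y.
  move=> Txc Scy; exists (p x c y).
    rewrite -{1}(malcev_l pV x y VQ); apply: Sp; [exact: S1 | | exact: S1].
    exact: S2.
  rewrite -{2}(malcev_r pV x y VQ); apply: Tp; [exact: T1 | | exact: T1].
  exact: T2.
split; first split.
- by move=> x; exists x.
- by move=> x y [c Sxc Tcy]; apply: (swap y c x); [apply: T2 | apply: S2].
- move=> x y z [c Sxc Tcy] [d Syd Tdz]; have [e Sce Ted] := swap _ _ _ Tcy Syd.
  by exists e; [apply: (S3 _ c) | apply: (T3 _ d)].
- move=> x x' y y' [c Sxc Tcx] [d Syd Tdy].
  by exists (qmul c d); [apply: SM | apply: TM].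
- move=> x x' y y' [c Sxc Tcx] [d Syd Tdy].
  by exists (qldiv c d); [apply: SD | apply: TD].
Qed.

Lemma cjoin_comp S T x y : congruence S -> congruence T ->
  cjoin S T x y -> exists2 c, S x c & T c y.
Proof.
move=> cS cT /(_ _ (comp_congruence cS cT)); apply.
  by move=> a b Sab; exists b => //; case: cT => -[].
by move=> a b Tab; exists a => //; case: cS => -[].
Qed.

(* [R] and [S] centralize each other modulo [N], here for the term (a * u) * w. *)
Lemma centrality R S N a b u v w w' :
  congruence R -> congruence S -> congruence N ->
  (forall x y, cmeet R S x y -> N x y) ->
  S a b -> R u v -> R w w' ->
  N (qmul (qmul a u) w) (qmul (qmul a v) w') ->
  N (qmul (qmul b u) w) (qmul (qmul b v) w').
Proof.
move=> cR cS cN RSN Sab Ruv Rw.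
have Rp x x' y y' z z' := @malcev_congruence V p pV Q R x x' y y' z z' cR.
have Sp x x' y y' z z' := @malcev_congruence V p pV Q S x x' y y' z z' cS.
have Np x x' y y' z z' := @malcev_congruence V p pV Q N x x' y y' z z' cN.
case: (cR) (cS) (cN) => [[R1 R2 R3] RM RD] [[S1 S2 S3] SM SD] [[N1 N2 N3] NM ND].
pose t x y z : Q := qmul (qmul x y) z.
rewrite -!/(t _ _ _) => Na.
have Rt x : R (t x u w) (t x v w') by exact: (RM _ _ _ _ (RM _ _ _ _ (R1 x) Ruv) Rw).
have St y z : S (t a y z) (t b y z).
  by exact: (SM _ _ _ _ (SM _ _ _ _ Sab (S1 y)) (S1 z)).
(* [Na] makes [c] [N]-related to [t b u w]; moreover both [R] and [S] relate [c] to [t b v w']. *)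
pose c := p (t b u w) (t a u w) (t a v w').
apply: (N3 _ c).
  by rewrite -{1}(malcev_l pV (t b u w) (t a u w) VQ); apply: Np.
apply: RSN; split.
  apply: (R3 _ (t b u w)) => //.
  rewrite -{1}(malcev_l pV (t b u w) (t a u w) VQ).
  apply: Rp; [exact: R1 | exact: R1 |].
  exact: R2.
apply: (S3 _ (t a v w')) => //.
rewrite -{1}(malcev_r pV (t a u w) (t a v w') VQ).
apply: Sp; [ | exact: S1 | exact: S1].
exact: S2.
Qed.

Lemma not_distributive_medial : ~ distributive_congruences Q ->
  exists P, [/\ V P, nontrivial P & medial P].
Proof.
move=> ndist.
(* One inclusion holds in every lattice, so only the other can fail. *)
have [R [S [T [x0 [y0 [cR cS cT [Rxy Jxy] nN]]]]]] : exists R S T x y,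
    [/\ congruence R, congruence S, congruence T, cmeet R (cjoin S T) x y
      & ~ cjoin (cmeet R S) (cmeet R T) x y].
  apply: contrapT => nex; apply: ndist => R S T cR cS cT x y; split.
    by move=> RST; apply: contrapT => nN; apply: nex; exists R, S, T, x, y.
  move=> /(_ _ (cmeet_congruence cR (cjoin_congruence S T))); apply.
    by move=> a b [Rab Sab]; split=> // U cU SU TU; apply: SU.
  by move=> a b [Rab Tab]; split=> // U cU SU TU; apply: TU.
pose N := cjoin (cmeet R S) (cmeet R T).
have cN : congruence N := cjoin_congruence _ _.
pose A := cmeet R (cjoin S T).
have cA : congruence A := cmeet_congruence cR (cjoin_congruence S T).
have [[A1 A2 A3] AM AD] := cA; have [[R1 R2 R3] RM RD] := cR.
have BM x y : A x0 x -> A x0 y -> A x0 (qmul x y).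
  by move=> Ax Ay; rewrite -(qmulxx x0); apply: AM.
have BD x y : A x0 x -> A x0 y -> A x0 (qldiv x y).
  move=> Ax Ay; have x0D := qmulK x0 x0; rewrite qmulxx in x0D.
  by rewrite -x0D; apply: AD.
pose B := sub_quandle BM BD.
have cNB : congruence (fun x y : B => N (proj1_sig x) (proj1_sig y)).
  exact: (@pullback_congruence B Q (@proj1_sig _ _)).
exists (quot_quandle cNB); split.
- by apply: variety_quot => //; apply: variety_sub.
- pose x1 : B := exist _ x0 (A1 x0); pose y1 : B := exist _ y0 (conj Rxy Jxy).
  exists (quot_pi _ x1), (quot_pi _ y1).
  by move/(quot_piP cNB).
move=> x y u v; rewrite -(quot_reprK x) -(quot_reprK y) -(quot_reprK u) -(quot_reprK v).
rewrite -!(quot_pi_hom cNB); apply/(quot_piP cNB) => /=.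
move: (quot_repr x) (quot_repr y) (quot_repr u) (quot_repr v) => {x y u v}.
move=> [x Ax] [y Ay] [u Au] [v Av] /=.
have Auy : A y u by apply: (A3 _ x0) => //; apply: A2.
have Ryu : R y u by case: Auy.
have Rw : R (qmul u v) (qmul y v) by apply: RM; [apply: R2 | apply: R1].
have [_ Jyx] : A y x by apply: (A3 _ x0) => //; apply: A2.
(* The medial law holds when [x] is replaced by [y]. Centrality of [R] with [S] moves [y] to [c],
   and centrality of [R] with [T] moves [c] to [x]. *)
have [c Syc Tcx] := cjoin_comp cS cT Jyx.
have RSN a b : cmeet R S a b -> N a b by move=> ? U cU RU SU; apply: RU.
have RTN a b : cmeet R T a b -> N a b by move=> ? U cU RU SU; apply: SU.
apply: (centrality cR cT cN RTN Tcx Ryu Rw).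
apply: (centrality cR cS cN RSN Syc Ryu Rw).
by rewrite qmulxx -qmulDr; case: cN => -[].
Qed.

End Commutator.

(** * Minimal finite quandles and Frobenius groups *)

Section FiniteMinimal.
Variables (X : finType) (mul ldiv : X -> X -> X).
Hypotheses (ldivK : forall x y, mul x (ldiv x y) = y)
  (mulK : forall x y, ldiv x (mul x y) = y) (mulxx : forall x, mul x x = x)
  (mulDr : forall x y z, mul x (mul y z) = mul (mul x y) (mul x z)).
Let Q := Quandle ldivK mulK mulxx mulDr.

Hypothesis min : forall A : {set X},
  (forall x y, x \in A -> y \in A -> mul x y \in A) ->
  (forall x y, x \in A -> y \in A -> ldiv x y \in A) ->
  (#|A| <= 1)%N \/ A = [set: X].
Hypothesis nproj : exists x y, mul x y != y.

Local Open Scope group_scope.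

Let L x : {perm X} := perm (can_inj (mulK x)).
Let G := <<[set L x | x in X]>>.

Let LE x y : L x y = mul x y. Proof. exact: permE. Qed.
Let LVE x y : (L x)^-1 y = ldiv x y.
Proof. by apply: (@perm_inj _ (L x)); rewrite permKV LE ldivK. Qed.

Let LG x : L x \in G. Proof. by apply/mem_gen/imsetP; exists x. Qed.

Let aut g x y : g \in G -> g (mul x y) = mul (g x) (g y).
Proof.
pose Aut := [set g : {perm X} | [forall x, forall y, g (mul x y) == mul (g x) (g y)]].
have AutP (g' : {perm X}) :
    reflect (forall x y, g' (mul x y) = mul (g' x) (g' y)) (g' \in Aut).
  rewrite inE; apply: (iffP forallP) => [H u v|H u]; first exact/eqP/(forallP (H u)).
  by apply/forallP => v; apply/eqP.
have gAut : group_set Aut.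
  apply/group_setP; split; first by apply/AutP => u v; rewrite !perm1.
  move=> g1 g2 /AutP H1 /AutP H2; apply/AutP => u v.
  by rewrite !permM H1 H2.
suff /fintype.subsetP sGA : G \subset Aut by move=> /sGA/AutP.
rewrite -[Aut]/(gval (Group gAut)) gen_subG; apply/fintype.subsetP => _ /imsetP[z _ ->].
by apply/AutP => u v; rewrite !LE mulDr.
Qed.

Let LJ x g : g \in G -> L (g x) = L x ^ g.
Proof.
by move=> Gg; apply/permP => y; rewrite conjgE !permM !LE aut // permKV.
Qed.

(** The inverse of [L x] is a power of [L x], so closure under [mul] implies closure under
    [ldiv]. *)
Let min_mul (A : {set X}) : (forall x y, x \in A -> y \in A -> mul x y \in A) ->
  (#|A| <= 1)%N \/ A = [set: X].
Proof.
move=> AM; apply: (min AM) => x y Ax; rewrite -LVE.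
have -> : (L x)^-1 = L x ^+ #[L x].-1 by rewrite invg_expg.
elim: _.-1 y => [|k IH] y Ay; first by rewrite perm1.
by rewrite expgS permM; apply/IH; rewrite LE AM.
Qed.

Let orbit_perm (J : {group {perm X}}) x y g :
  y \in orbit 'P J x -> g \in J -> g y \in orbit 'P J x.
Proof.
case/imsetP => h Jh -> Jg.
have -> : g ('P%act x h) = 'P%act x (h * g) by rewrite /= /aperm permM.
exact: mem_orbit (groupM Jh Jg).
Qed.

(** Orbits are subquandles, and the orbit of a point moved by some translation has more than one
    element. *)
Let trG : [transitive G, on [set: X] | 'P].
Proof.
have orbitM x u v : u \in orbit 'P G x -> v \in orbit 'P G x ->
    mul u v \in orbit 'P G x.
  by move=> _ xv; rewrite -LE orbit_perm.
have [x [y xy]] := nproj.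
have [|/card_le1_eqP/(_ y (L x y))|yT] := min_mul (A := orbit 'P G y).
- exact: orbitM.
- rewrite orbit_refl orbit_perm ?orbit_refl // LE => /(_ isT isT) E.
  by rewrite E eqxx in xy.
- by apply/imsetP; exists y; rewrite ?inE.
Qed.

Let L_neq1 x : L x != 1.
Proof.
apply/eqP => Lx1; have [u [v]] := nproj.
have [g Gg ->] : exists2 g, g \in G & u = g x.
  have : u \in orbit 'P G x by rewrite (atransP trG) ?inE.
  by case/imsetP => g Gg /= ->; exists g.
by rewrite -LE LJ // Lx1 conj1g perm1 eqxx.
Qed.

(** The fixed points of an automorphism form a subquandle, to which minimality applies. This is the
    Frobenius condition. *)
Let fix_le1 g : g \in G -> g != 1 -> forall x y, g x = x -> g y = y -> x = y.
Proof.
move=> Gg g1 x y gx gy.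
have [|/card_le1_eqP|AT] := min_mul (A := [set z | g z == z]).
- by move=> u v; rewrite !inE => /eqP gu /eqP gv; rewrite aut // gu gv.
- by apply; rewrite inE ?gx ?gy.
case/eqP: g1; apply/permP => z; rewrite perm1; apply/eqP.
have : z \in [set z | g z == z] by rewrite AT inE.
by rewrite inE.
Qed.

Lemma finite_minimal_medial : medial Q.
Proof.
have [x _] := nproj.
pose H := 'C_G[x | 'P].
have LH : L x \in H.
  by apply/setIP; split=> //; apply/astab1P; rewrite /= /aperm LE mulxx.
have frobH : [Frobenius G with complement H].
  apply/Frobenius_actionP; apply: (@hasFrobeniusAction _ _ _ _ [set: X] 'P).
  split=> //.
  - rewrite /faithful; apply/fintype.subsetP => g /setIP[_ /astabP gx]; rewrite inE.
    by apply/eqP/permP => y; rewrite perm1; apply: gx; rewrite inE.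
  - move=> g /setD1P[g1 Gg]; apply/card_le1_eqP => u v.
    by move=> /setIP[_ /afix1P gu] /setIP[_ /afix1P gv]; apply: (fix_le1 Gg g1).
  - by apply/trivgPn; exists (L x); rewrite ?L_neq1.
  - by exists x.
have [K frobK] := Frobenius_kernel_exists frobH.
have [defG K1 _ _ _] := Frobenius_context frobK.
have [nKG _ _ nKH KH1] := sdprod_context defG.
have co_KH := Frobenius_coprime frobK.
have sKG : K \subset G := normal_sub nKG.
have nKL y : L y \in 'N(K) by apply: (fintype.subsetP (normal_norm nKG)); apply: LG.
have K_reg k : k \in K -> k x = x -> k = 1.
  move=> Kk kx; apply/set1gP; rewrite -KH1; apply/setIP; split=> //.
  by apply/setIP; split; [apply: (fintype.subsetP sKG) | apply/astab1P].
(* The orbit of [x] under [J] is a subquandle, and [K] is regular. *)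
have K_irr (J : {group {perm X}}) : J \subset K -> L x \in 'N(J) ->
    J :!=: 1 -> K \subset J.
  move=> sJK nJL J1.
  have LO z : z \in orbit 'P J x -> mul x z \in orbit 'P J x.
    case/imsetP => j Jj -> /=; rewrite /aperm -LE -permM conjgC permM LE mulxx.
    by apply: (mem_orbit 'P); rewrite memJ_norm.
  have [|/card_le1_eqP|OT] := min_mul (A := orbit 'P J x).
  - move=> u z /imsetP[j Jj ->] zO; rewrite -LE /= /aperm LJ; last first.
      exact: (fintype.subsetP (fintype.subset_trans sJK sKG)).
    rewrite conjgE !permM; apply: orbit_perm => //; rewrite LE; apply: LO.
    by apply: orbit_perm; rewrite ?groupV.
  - move=> OJ; case/eqP: J1; apply/trivgP/fintype.subsetP => j Jj.
    rewrite inE; apply/eqP/K_reg; first exact: (fintype.subsetP sJK).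
    exact: OJ (orbit_refl _ _ _) (mem_orbit 'P x Jj).
  apply/fintype.subsetP => k Kk; have : k x \in orbit 'P J x by rewrite OT inE.
  case/imsetP => j Jj /= kj; suff : k * j^-1 = 1.
    by move/eqP; rewrite -eq_mulgV1 => /eqP->.
  apply: K_reg; first by rewrite groupM ?groupV // (fintype.subsetP sJK).
  by rewrite permM kj permK.
pose p := pdiv #|K|.
have p_pr : prime p by rewrite pdiv_prime // cardG_gt1.
(* [L x] lies in the complement [H], so the cyclic group it generates acts coprimely on [K] and
   normalizes a Sylow subgroup, which [K_irr] makes all of [K]. The center of [K] is treated
   likewise. *)
have [||| P sylP nPL] := @sol_coprime_Sylow_exists _ p <[L x]>%G K.
- exact/abelian_sol/cycle_abelian.
- by rewrite cycle_subG.
- by apply: coprimegS co_KH; rewrite cycle_subG.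
have pK : p.-group K.
  apply: pgroupS (pHall_pgroup sylP); apply: K_irr; first exact: pHall_sub sylP.
    by rewrite -cycle_subG.
  by rewrite -cardG_gt1 (card_Hall sylP) p_part_gt1 pi_pdiv cardG_gt1.
have abK : abelian K.
  apply/center_idP/eqP; rewrite finset.eqEsubset center_sub; apply: K_irr.
  - exact: center_sub.
  - exact: (fintype.subsetP (char_norms (center_char K))).
  - by apply/eqP => Z1; case/eqP: K1; apply: (trivg_center_pgroup pK Z1).
(* As [G = H K] and [H] fixes [x], [u] is [k x] for some [k] in [K]; then [L u] is [L x ^ k] and the
   element is the commutator of [L x] and [k]. *)
have LxK u : (L x)^-1 * L u \in K.
  have : u \in orbit 'P G x by rewrite (atransP trG) ?inE.
  have GE : G = H * K.
    by rewrite (normC nKH); apply/esym/(sdprodW defG).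
  case/imsetP => g Gg ->; have : g \in H * K by rewrite -GE.
  case/mulsgP => h k /setIP[_ /astab1P hx] Kk ->.
  have -> : 'P%act x (h * k) = k x.
    by rewrite -[in RHS]hx /= /aperm permM.
  rewrite LJ ?(fintype.subsetP sKG) // -commgEl commgEr groupM //.
  by rewrite memJ_norm ?groupV // nKL.
have LK u v : (L u)^-1 * L v \in K.
  rewrite -(mulKVg (L x) (L v)) mulgA groupM //.
  by rewrite -groupV invMg invgK.
(* Mediality becomes [L c * (L a)^-1 * L b = L b * (L a)^-1 * L c], the commutation of two elements
   of [K]. *)
move=> a b c d; rewrite /= -!LE !LJ // !conjgE -!permM.
have /(congr1 (fun g => L a * (g * L a))) :=
  centP (fintype.subsetP abK _ (LK a b)) _ (LK a c).
by rewrite !mulgA !mulgV !mul1g => <-.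
Qed.
End FiniteMinimal.

(** * Finite members of least size in a variety *)

Section FiniteQuandles.
Variable V : quandle -> Prop.
Hypothesis vV : variety V.

(** Carriers are transported to ordinals so that the size becomes a number to be minimized. *)
Definition ordinal_model n := exists (mul ldiv : 'I_n -> 'I_n -> 'I_n) h1 h2 h3 h4,
  let Q := @Quandle 'I_n mul ldiv h1 h2 h3 h4 in V Q /\ nontrivial Q.

Lemma ordinal_model_iso (Q : quandle) n (f : Q -> 'I_n) (g : 'I_n -> Q) :
  cancel f g -> cancel g f -> V Q -> nontrivial Q -> ordinal_model n.
Proof.
move=> fK gK VQ [x [y xNy]].
exists (fun i j => f (qmul (g i) (g j))), (fun i j => f (qldiv (g i) (g j))).
have h1 i j : f (qmul (g i) (g (f (qldiv (g i) (g j))))) = j.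
  by rewrite fK qldivK gK.
have h2 i j : f (qldiv (g i) (g (f (qmul (g i) (g j))))) = j.
  by rewrite fK qmulK gK.
have h3 i : f (qmul (g i) (g i)) = i by rewrite qmulxx gK.
have h4 i j k : f (qmul (g i) (g (f (qmul (g j) (g k))))) =
    f (qmul (g (f (qmul (g i) (g j)))) (g (f (qmul (g i) (g k))))).
  by rewrite !fK qmulDr.
exists h1, h2, h3, h4 => /=; split; last first.
  by exists (f x), (f y) => /= /(can_inj fK).
set P := Quandle h1 h2 h3 h4; have gM : @qhom P Q g by move=> i j; rewrite /= fK.
exact: variety_inj vV gM (can_inj gK) VQ.
Qed.

Lemma finite_ordinal_model (Q : quandle) :
  finite_quandle Q -> V Q -> nontrivial Q -> exists n, ordinal_model n.
Proof.
move=> finQ VQ ntQ.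
have /finite_seqP[s sE] : finite_set [set: {classic Q}]%classic by [].
have us (x : {classic Q}) : x \in undup s.
  by rewrite mem_undup; have : [set: {classic Q}]%classic x by []; rewrite sE.
exists (size (undup s)).
have ltx (x : {classic Q}) : (index x (undup s) < size (undup s))%N.
  by rewrite index_mem.
case: ntQ => x0 [y0 xy0].
apply: (@ordinal_model_iso Q _ (fun x => Ordinal (ltx x))
  (fun i => nth (x0 : {classic Q}) (undup s) i)) => //.
- by move=> x; rewrite /= nth_index.
- by move=> i; apply: val_inj; rewrite /= index_uniq ?undup_uniq.
by exists x0, y0.
Qed.

Lemma finite_medial s r : rightmost s <> rightmost r ->
  (forall Q, V Q -> satisfies Q s r) ->
  (exists Q, V Q /\ nontrivial Q /\ finite_quandle Q) ->
  exists Q, [/\ V Q, nontrivial Q & medial Q].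
Proof.
move=> srN Vsr [Q0 [VQ0 [ntQ0 finQ0]]].
have [n0 Pn0] := finite_ordinal_model finQ0 VQ0 ntQ0.
have exP : exists n, `[< ordinal_model n >] by exists n0; apply/asboolP.
case: (ex_minnP exP) => n /asboolP[mul [ldiv [h1 [h2 [h3 [h4 [VQ ntQ]]]]]]] minP.
set Q := Quandle h1 h2 h3 h4 in VQ ntQ.
exists Q; split=> //; apply: finite_minimal_medial.
- move=> A AM AD; have [|A_gt1] := leqP #|A| 1; first by left.
  right; apply/eqP; rewrite eqEcard finset.subsetT cardsT card_ord /=.
  apply: minP; apply/asboolP.
  have [x [y [Ax Ay xy]]] : exists x y, [/\ x \in A, y \in A & x != y].
    by have /card_gt1P := A_gt1.
  pose B := @sub_quandle Q (fun z => z \in A) AM AD.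
  apply: (@ordinal_model_iso B #|A| (fun z => enum_rank_in Ax (proj1_sig z))
    (fun i => exist _ (enum_val i) (enum_valP i))).
  - by move=> [z Az]; apply: sig_inj; rewrite /= enum_rankK_in.
  - by move=> i; rewrite /= enum_valK_in.
  - exact: variety_sub.
  by exists (exist _ x Ax), (exist _ y Ay) => -[]; apply/eqP.
(* In a projection quandle a term evaluates to its rightmost variable, so the identity [s = r] would
   give [x = y]. *)
apply: contrapT => nproj; have [x [y xy]] := ntQ; apply: xy.
have mulE (u v : Q) : qmul u v = v.
  by apply: contrapT => uv; apply: nproj; exists u, v; apply/eqP.
have evalE (e : nat -> Q) t : qeval e t = e (rightmost t).
  elim: t => //= t1 _ t2 <-; first exact: mulE.
  by rewrite -[LHS](mulE (qeval e t1)) qldivK.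
have := Vsr Q VQ (fun n => if n == rightmost s then x else y).
by rewrite !evalE eqxx eq_sym; case: eqP.
Qed.

End FiniteQuandles.

Theorem theorem4p9 (V : quandle -> Prop) (hV : variety V) :
  ((exists Q : quandle, V Q /\ nontrivial Q /\ abelian_quandle Q) <->
   (exists Q : quandle, V Q /\ nontrivial Q /\ finite_quandle Q)) /\
  (congruence_distributive V <->
   ~ (exists Q : quandle, V Q /\ nontrivial Q /\ finite_quandle Q)).
Proof.
have [[s [r [srN Vsr]]]|noid] := pselect (exists s r, rightmost s <> rightmost r /\
    forall Q, V Q -> satisfies Q s r).
  have [p pV] := malcev_exists srN Vsr.
  have medial_aff Q : V Q -> nontrivial Q -> medial Q ->
      exists (G : zmodType) (T : {additive G -> G}) (T' : G -> G)
        (TK : cancel T T') (T'K : cancel T' T),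
      V (aff TK T'K) /\ nontrivial (aff TK T'K).
    move=> VQ [x [y xNy]] mQ.
    have [G [T [T' [TK [T'K [f [fM [g fK gK]]]]]]]] := medial_affine pV VQ mQ x.
    exists G, T, T', TK, T'K; split; first exact: (variety_inj hV fM (can_inj fK)).
    by exists (g x), (g y) => /(can_inj gK).
  have medial_finite Q : V Q -> nontrivial Q -> medial Q ->
      exists Q : quandle, V Q /\ nontrivial Q /\ finite_quandle Q.
    move=> VQ ntQ mQ; have [G [T [T' [TK [T'K [VA ntA]]]]]] := medial_aff _ VQ ntQ mQ.
    exact: (aff_finite hV srN (Vsr _ VA) VA ntA).
  have finite_aff := fun F => let: ex_intro Q (And3 VQ ntQ mQ) :=
    finite_medial hV srN Vsr F in medial_aff Q VQ ntQ mQ.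
  split; split.
  - by move=> [Q [VQ [ntQ /abelian_medial mQ]]]; apply: medial_finite VQ ntQ mQ.
  - move=> /finite_aff[G [T [T' [TK [T'K [VA ntA]]]]]].
    by exists (aff TK T'K); split=> //; split=> //; apply: aff_abelian.
  - move=> cdV /finite_aff[G [T [T' [TK [T'K [VA ntA]]]]]].
    exact: aff_not_distributive ntA (cdV _ (variety_pair hV VA VA)).
  - move=> nofin Q VQ; apply: contrapT => nd; apply: nofin.
    have [P [VP ntP mP]] := not_distributive_medial hV pV VQ nd.
    exact: medial_finite VP ntP mP.
(* No identity of [V] changes the rightmost variable, so the projection quandle on [Z/2] satisfies
   them all. *)
have TK : cancel (idfun : 'Z_2 -> 'Z_2) idfun by [].
pose A := aff (T := idfun) TK TK.
have VA : V A.
  case: (hV) => E VE; apply/VE => s r Esr.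
  have [e|srN] := pselect (rightmost s = rightmost r).
    by move=> x; rewrite !aff_id_eval e.
  by case: noid; exists s, r; split=> // Q /VE; apply.
have ntA : nontrivial A by exists (0 : 'Z_2), (1 : 'Z_2).
have finA : finite_quandle A by apply: (@finite_finset 'Z_2).
split; split.
- by exists A.
- by exists A; split=> //; split=> //; apply: aff_abelian.
(* Both sides of the second equivalence are false here. *)
- move=> cdV.
  by case: (aff_not_distributive ntA (cdV _ (variety_pair hV VA VA))).
- by case; exists A.
Qed.
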